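(* There exists an infinite family of (pairwise non-isomorphic) Turánable oriented graphs, none of which is a subgraph of $D_s$ for any positive integer $s$.
   Context: An oriented graph is a digraph without loops, parallel edges, or 2-cycles. A regular tournament is a tournament in which every vertex has in-degree equal to out-degree. An oriented graph $H$ is Turánable if there exists $n_0$ such that every regular tournament on $n\geqslant n_0$ vertices contains a copy of $H$ as a (not necessarily induced) subdigraph. $TT_s$ is the transitive tournament on $s$ vertices, and $D_s=D_{s,s,s}$ is the tournament on $3s$ vertices obtained from the directed triangle $C_3$ by replacing each of its vertices with a copy of $TT_s$ (all edges between two copies being directed as the corresponding edge of $C_3$). *)

(* Defs.v *)
From mathcomp Require Import all_boot.

Set Implicit Arguments.
Unset Strict Implicit.
Unset Printing Implicit Defensive.

(* Parallel arcs cannot occur, since the arcs form a relation. *)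
Record oriented_graph := OrientedGraph {
  vertex :> finType;
  arc : rel vertex;
  arc_irrefl : irreflexive arc;
  arc_no_2cycle : forall x y : vertex, ~~ (arc x y && arc y x)
}.

Definition indegree (G : oriented_graph) (x : G) : nat := #|[set y | arc y x]|.
Definition outdegree (G : oriented_graph) (x : G) : nat := #|[set y | arc x y]|.

Definition tournament (G : oriented_graph) : Prop :=
  forall x y : G, x != y -> arc x y || arc y x.

Definition regular_tournament (G : oriented_graph) : Prop :=
  tournament G /\ forall x : G, indegree x = outdegree x.

(* [H] is a (not necessarily induced) subdigraph of [G], up to isomorphism. *)
Definition contains_copy (G H : oriented_graph) : Prop :=
  exists2 f : H -> G, injective f & forall x y : H, arc x y -> arc (f x) (f y).

Definition isomorphic (G H : oriented_graph) : Prop :=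
  exists2 f : G -> H, bijective f & forall x y : G, arc (f x) (f y) = arc x y.

Definition turanable (H : oriented_graph) : Prop :=
  exists n0 : nat, forall T : oriented_graph,
    regular_tournament T -> n0 <= #|T| -> contains_copy T H.

Definition TT_arc (s : nat) : rel 'I_s := fun x y => x < y.

Fact TT_irrefl s : irreflexive (@TT_arc s).
Proof. by move=> x; rewrite /TT_arc ltnn. Qed.

Fact TT_no_2cycle s (x y : 'I_s) : ~~ (TT_arc x y && TT_arc y x).
Proof. by rewrite /TT_arc; case: ltngtP. Qed.

Definition TT (s : nat) : oriented_graph :=
  OrientedGraph (@TT_irrefl s) (@TT_no_2cycle s).

Definition C3_arc : rel 'I_3 := fun x y => y == ordS x.

Fact C3_irrefl : irreflexive C3_arc.
Proof. by case=> [[|[|[|]]]]. Qed.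

Fact C3_no_2cycle (x y : 'I_3) : ~~ (C3_arc x y && C3_arc y x).
Proof. by case: x y => [[|[|[|]]] ? //] [[|[|[|]]] ? //]. Qed.

Definition C3 : oriented_graph := OrientedGraph C3_irrefl C3_no_2cycle.

(* Replacing each vertex of [G] with a copy of [H]: [(i, x)] is the vertex [x]
   of the copy of [H] that replaces [i]. *)
Definition subst_arc (G H : oriented_graph) : rel (G * H) :=
  fun u v => arc u.1 v.1 || (u.1 == v.1) && arc u.2 v.2.

Fact subst_irrefl (G H : oriented_graph) : irreflexive (@subst_arc G H).
Proof. by move=> u; rewrite /subst_arc !arc_irrefl andbF. Qed.

Fact subst_no_2cycle (G H : oriented_graph) (u v : G * H) : ~~ (subst_arc u v && subst_arc v u).
Proof.
case: u v => [i x] [j y]; rewrite /subst_arc /= [j == i]eq_sym.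
have [<-|_] := eqVneq i j; first by rewrite !arc_irrefl arc_no_2cycle.
by rewrite !orbF arc_no_2cycle.
Qed.

Definition subst_graph (G H : oriented_graph) : oriented_graph :=
  OrientedGraph (@subst_irrefl G H) (@subst_no_2cycle G H).

Definition D (s : nat) : oriented_graph := subst_graph C3 (TT s).

(* Main.v *)
Require Import Defs.
From mathcomp Require Import all_boot zify.
(* [path.arc] of [all_boot] would otherwise shadow [arc]. *)
Import Defs.

(* The 6-vertex graph consists of a triangle p0 p1 p2, of the triangles x p1 p2
   and p0 p1 z sharing an edge with it, and of a vertex a dominating x, p1 and
   z; isolated vertices are added to get an infinite family.

   In a copy inside D_s every triangle meets the three parts, so x, p1 and z lie
   in three different parts, whereas the out-neighbourhood of a vertex meets
   only two parts.

   Let v be a vertex of a regular tournament with degrees k, O and I its out-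
   and in-neighbourhoods, M a vertex of maximum in-degree in O, and s its
   out-degree in O.  If the tournament has no copy of the graph, then the arcs
   from N+(M) to N-(M) inside O contain no path z p0 p2 x (otherwise take p1 = M
   and a = v), so they form a star forest and number at most k.  By maximality
   of M each y in N+(M) sends more arcs to N-(M) than it receives from N+(M), so
   they number at least s(s+1)/2.  Hence s = O(sqrt k) and M dominates almost
   all of I.  Taking p1 = v, p2 = M and z in O with large in- and out-degree in
   O, one finds a and then x in I among the in-neighbours of z, and p0 in I
   among its out-neighbours. *)

Set Implicit Arguments.
Unset Strict Implicit.
Unset Printing Implicit Defensive.

(** * The six-vertex graph with added isolated vertices *)

(* p0, p1, p2, x, z, a are numbered from 0 to 5. *)
Definition fan_arcs : seq (nat * nat) :=
  [:: (0, 1); (1, 2); (2, 0); (2, 3); (3, 1); (1, 4); (4, 0);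
      (5, 3); (5, 1); (5, 4)].

Definition fan_arc m : rel 'I_m :=
  fun u v => (val u, val v) \in fan_arcs.

Fact fan_irrefl m : irreflexive (@fan_arc m).
Proof.
move=> u; apply/negP=> uu.
have /allP/(_ _ uu)/= : all (fun e => e.1 != e.2) fan_arcs by [].
by rewrite eqxx.
Qed.

Fact fan_no_2cycle m (u v : 'I_m) : ~~ (fan_arc u v && fan_arc v u).
Proof.
apply/negP=> /andP[uv vu].
have /allP/(_ _ uv)/= : all (fun e => (e.2, e.1) \notin fan_arcs) fan_arcs by [].
by rewrite -[_ \in _]/(fan_arc v u) vu.
Qed.

Definition fan (m : nat) : oriented_graph :=
  OrientedGraph (@fan_irrefl m) (@fan_no_2cycle m).

Lemma arc_neq (T : oriented_graph) (u v : T) : arc u v -> u != v.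
Proof. by apply: contraTneq => ->; rewrite arc_irrefl. Qed.

Lemma arc_asym (T : oriented_graph) (u v : T) : arc u v -> ~~ arc v u.
Proof. by move=> uv; have := arc_no_2cycle u v; rewrite uv. Qed.

(** Two inequalities suffice: any other two of the six vertices are joined by an arc or by a
    directed path of length two. *)
Definition has_fan (T : oriented_graph) : bool :=
  [exists p0 : T, exists p1 : T, exists p2 : T,
   exists x : T, exists z : T, exists a : T,
    [&& [&& arc p0 p1, arc p1 p2 & arc p2 p0], arc p2 x && arc x p1,
        arc p1 z && arc z p0, [&& arc a x, arc a p1 & arc a z]
      & (p0 != x) && (p2 != z)]].

Lemma has_fanI (T : oriented_graph) (p0 p1 p2 x z a : T) :
  arc p0 p1 -> arc p1 p2 -> arc p2 p0 -> arc p2 x -> arc x p1 ->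
  arc p1 z -> arc z p0 -> arc a x -> arc a p1 -> arc a z ->
  p0 != x -> p2 != z -> has_fan T.
Proof.
move=> *; apply/existsP; exists p0; apply/existsP; exists p1.
apply/existsP; exists p2; apply/existsP; exists x; apply/existsP; exists z.
by apply/existsP; exists a; do !(apply/andP; split).
Qed.

(** * No copy inside [D s] *)

(** An arc stays in its part or moves to the next, so a triangle makes 0 or 3 moves; 0 is excluded
    because each part is transitive. *)
Lemma D_triangle s (x y w : D s) :
  arc x y -> arc y w -> arc w x -> y.1 = ordS x.1.
Proof.
case: x y w => [i x] [j y] [l w]; rewrite /= /subst_arc /= /C3_arc /TT_arc.
have [-> //|_ /=] := eqVneq j (ordS i).
case/andP=> /eqP<- xy; rewrite [w < x]ltnNge [l == i]eq_sym.
have [->|_] := eqVneq i l.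
  case/orP=> [|yw]; first by case: (l) => [[|[|[|]]]].
  case/orP=> [|/negP[]]; first by case: (l) => [[|[|[|]]]].
  by case/andP: yw => _ /(ltn_trans xy)/ltnW.
rewrite !orbF => /eqP->.
by case: (i) => [[|[|[|]]]].
Qed.

Lemma D_fan_free s m : 6 <= m -> ~ contains_copy (D s) (fan m).
Proof.
move=> m6 [f _ farc].
pose o i (im : i < 6) : fan m := Ordinal (leq_trans im m6).
pose q i im := f (@o i im).
have A i j (im : i < 6) (jm : j < 6) : (i, j) \in fan_arcs -> arc (q i im) (q j jm).
  by move=> ij; apply: farc.
have h1 := D_triangle (A 0 1 isT isT isT) (A 1 2 isT isT isT) (A 2 0 isT isT isT).
have h2 := D_triangle (A 3 1 isT isT isT) (A 1 2 isT isT isT) (A 2 3 isT isT isT).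
have h3 := D_triangle (A 1 4 isT isT isT) (A 4 0 isT isT isT) (A 0 1 isT isT isT).
have := A 5 3 isT isT isT; have := A 5 1 isT isT isT; have := A 5 4 isT isT isT.
rewrite /arc /= /subst_arc h3 h2 /= /C3_arc.
(* [i] and [j] are the parts of a and x; p1 and z lie in the parts [ordS j] and [ordS (ordS j)]. *)
move: (q 5 isT).1 (q 3 isT).1 => i j.
move=> /orP h4 /orP h5 /orP h6.
have {}h4 : (ordS (ordS j) == ordS i) || (i == ordS (ordS j)).
  by case: h4 => [->|/andP[->]]; rewrite ?orbT.
have {}h5 : (ordS j == ordS i) || (i == ordS j).
  by case: h5 => [->|/andP[->]]; rewrite ?orbT.
have {}h6 : (j == ordS i) || (i == j).
  by case: h6 => [->|/andP[->]]; rewrite ?orbT.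
by case: i j h4 h5 h6 => [[|[|[|]]] ? //] [[|[|[|]]] ? //].
Qed.

Lemma has_fan_copy (T : oriented_graph) m :
  m <= #|T| -> has_fan T -> contains_copy T (fan m).
Proof.
move=> mT /existsP[p0 /existsP[p1 /existsP[p2 /existsP[x /existsP[z]]]]].
case/existsP=> a /and5P[/and3P[a01 a12 a20] /andP[a23 a31] /andP[a14 a40]].
move=> /and3P[a53 a51 a54] /andP[n03 n24].
have neq (u v : T) : arc u v -> (u == v) = false by move/arc_neq/negbTE.
have neq2 (u v w : T) : arc u v -> arc v w -> (u == w) = false.
  by move=> uv /arc_asym; apply: contraNF => /eqP<-.
pose s0 := [:: p0; p1; p2; x; z; a].
have us0 : uniq s0.
  rewrite /= !inE !negb_or n03 n24 /= andbT.
  rewrite (neq _ _ a01) (neq _ _ a12) (neq _ _ a23) (neq _ _ a14) (neq2 _ _ _ a31 a14).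
  rewrite ![p0 == _]eq_sym (neq _ _ a20) (neq _ _ a40) (neq2 _ _ _ a54 a40).
  rewrite ![p1 == _]eq_sym (neq _ _ a31) (neq _ _ a51).
  by rewrite ![_ == a]eq_sym (neq2 _ _ _ a51 a12) (neq _ _ a53) (neq _ _ a54).
(* The other vertices of [T] follow, to host the isolated vertices. *)
pose s := s0 ++ [seq t <- enum T | t \notin s0].
have us : uniq s.
  rewrite cat_uniq us0 filter_uniq ?enum_uniq // andbT.
  by apply/hasPn=> t; rewrite mem_filter => /andP[].
have ss : #|T| <= size s.
  rewrite cardT; apply: uniq_leq_size; first exact: enum_uniq.
  move=> t tT; rewrite mem_cat mem_filter tT andbT.
  by case: (t \in s0).
have lt_s (u : 'I_m) : u < size s by apply: leq_trans ss; apply: leq_trans mT.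
exists (fun u : fan m => nth p0 s u).
  by move=> u v /eqP; rewrite nth_uniq ?lt_s // => /eqP/val_inj.
move=> u v; rewrite /arc /= /fan_arc !inE !xpair_eqE /=.
by do ?[case/orP]; case/andP=> /eqP-> /eqP->.
Qed.

(** * Counting edges and degrees *)

Lemma card_set_sum (I : finType) (A : {set I}) (P : pred I) :
  #|[set x in A | P x]| = \sum_(x in A) P x.
Proof.
rewrite -sum1_card big_mkcond [RHS]big_mkcond; apply: eq_bigr => x _.
by rewrite inE; case: (x \in A); case: (P x).
Qed.

(* An edge of a bipartite graph without a path on four vertices has an end of degree 1. *)
Lemma star_forest_edges (T : finType) (e : rel T) (Y Z : {set T}) :
  (forall y y' w w', y \in Y -> y' \in Y -> w \in Z -> w' \in Z ->
     y != y' -> w != w' -> e y w -> e y w' -> e y' w -> False) ->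
  \sum_(y in Y) #|[set w in Z | e y w]| <= #|Y| + #|Z|.
Proof.
move=> noP.
pose N y := [set w in Z | e y w].
pose Y2 := [set y in Y | 1 < #|N y|].
(* Edges at a vertex of degree at most 1 in [Y] are charged to that vertex, the others to their end
   in [Z]. *)
apply: (@leq_trans (\sum_(y in Y) 1 + \sum_(y in Y2) #|N y|)).
  rewrite [X in _ + X](eq_bigl (fun y => (y \in Y) && (1 < #|N y|))); last first.
    by move=> y; rewrite !inE.
  rewrite [X in _ + X]big_mkcondr -big_split /=.
  by apply: leq_sum => y _; case: ltnP => h; rewrite -/(N y); lia.
rewrite sum1_card leq_add2l.
under eq_bigr => y _ do rewrite card_set_sum.
rewrite exchange_big /= -sum1_card; apply: leq_sum => w wZ.
rewrite -card_set_sum; apply/card_le1_eqP => y' y.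
rewrite !inE => /andP[/andP[y'Y _] y'w] /andP[/andP[yY deg_y] yw].
have [//|yy'] := eqVneq y y'.
(* A second neighbour of [y] would complete the forbidden path [y'], [w], [y], [w1]. *)
have [w1] : exists w1, w1 \in N y :\ w.
  by apply/card_gt0P; move: deg_y; rewrite (cardsD1 w (N y)) inE wZ yw.
rewrite !inE => /and3P[w1w w1Z yw1].
by case: (noP y y' w w1) => //; rewrite eq_sym.
Qed.

Definition outs (T : oriented_graph) (x : T) (A : {set T}) :=
  [set y in A | arc x y].
Definition ins (T : oriented_graph) (x : T) (A : {set T}) :=
  [set y in A | arc y x].

Lemma outsC (T : oriented_graph) (x y : T) (A : {set T}) :
  outs x (outs y A) = outs y (outs x A).
Proof. by apply/setP=> w; rewrite !inE andbAC. Qed.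

Lemma insC (T : oriented_graph) (x y : T) (A : {set T}) :
  ins x (ins y A) = ins y (ins x A).
Proof. by apply/setP=> w; rewrite !inE andbAC. Qed.

Lemma outs_ins (T : oriented_graph) (x y : T) (A : {set T}) :
  outs x (ins y A) = ins y (outs x A).
Proof. by apply/setP=> w; rewrite !inE andbAC. Qed.

Lemma card_outs_ins (T : oriented_graph) (x : T) (A : {set T}) :
  tournament T -> #|outs x A| + #|ins x A| = #|A :\ x|.
Proof.
move=> tourT.
rewrite -cardsUI (_ : _ :&: _ = set0) ?cards0 ?addn0; last first.
  apply/setP=> y; rewrite !inE andbACA.
  by rewrite (negbTE (arc_no_2cycle x y)) andbF.
apply: eq_card => y; rewrite !inE -andb_orr andbC.
have [->|yx] := eqVneq y x; first by rewrite arc_irrefl.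
by rewrite orbC tourT.
Qed.

Lemma sum_outs_ins (T : oriented_graph) (A : {set T}) :
  \sum_(x in A) #|outs x A| = \sum_(x in A) #|ins x A|.
Proof.
under eq_bigr => x _ do rewrite card_set_sum.
by rewrite exchange_big /=; apply: eq_bigr => x _; rewrite -card_set_sum.
Qed.

Lemma sum_outs (T : oriented_graph) (A : {set T}) :
  tournament T -> (\sum_(x in A) #|outs x A|).*2 = #|A| * #|A|.-1.
Proof.
move=> tourT.
rewrite -addnn {2}sum_outs_ins -big_split /=.
rewrite (eq_bigr (fun=> #|A|.-1)) ?sum_nat_const // => x xA.
by rewrite card_outs_ins // [in RHS](cardsD1 x A) xA.
Qed.

(** The average of [f] over [A] is (|A| - 1)/2. *)
Lemma exists_ge_average (I : finType) (A : {set I}) (f : I -> nat) :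
  (\sum_(x in A) f x).*2 = #|A| * #|A|.-1 -> 0 < #|A| ->
  exists2 x, x \in A & #|A| <= (f x).*2.+1.
Proof.
move=> sumf A0; apply/exists_inP; apply: contraT => /exists_inPn small.
exfalso.
have : \sum_(x in A) (f x).*2.+2 <= \sum_(x in A) #|A|.
  by apply: leq_sum => x /small; rewrite -ltnNge.
rewrite sum_nat_const.
under eq_bigr => x _ do rewrite -addn2 -muln2.
rewrite big_split /= sum_nat_const -big_distrl /= muln2 sumf; nia.
Qed.

Lemma large_outs (T : oriented_graph) (A : {set T}) :
  tournament T -> 0 < #|A| -> exists2 x, x \in A & #|A| <= #|outs x A|.*2.+1.
Proof. by move=> tourT; apply/exists_ge_average/sum_outs. Qed.

Lemma large_ins (T : oriented_graph) (A : {set T}) :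
  tournament T -> 0 < #|A| -> exists2 x, x \in A & #|A| <= #|ins x A|.*2.+1.
Proof.
by move=> tourT; apply: exists_ge_average; rewrite -sum_outs_ins sum_outs.
Qed.

(** Apply [large_outs] to the set of low-degree vertices itself: degrees inside it are also at most
    [m]. *)
Lemma few_small_outs (T : oriented_graph) (A : {set T}) m :
  tournament T -> #|[set x in A | #|outs x A| <= m]| <= m.*2.+1.
Proof.
move=> tourT; set B := [set _ in _ | _].
have [->//|B0] := posnP #|B|.
have [x xB /leq_trans->//] := large_outs tourT B0.
move: xB; rewrite inE => /andP[_ xm]; rewrite ltnS leq_double.
apply: leq_trans xm; apply/subset_leq_card/subsetP => y.
by rewrite !inE => /andP[/andP[-> _] ->].
Qed.

Lemma few_small_ins (T : oriented_graph) (A : {set T}) m :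
  tournament T -> #|[set x in A | #|ins x A| <= m]| <= m.*2.+1.
Proof.
move=> tourT; set B := [set _ in _ | _].
have [->//|B0] := posnP #|B|.
have [x xB /leq_trans->//] := large_ins tourT B0.
move: xB; rewrite inE => /andP[_ xm]; rewrite ltnS leq_double.
apply: leq_trans xm; apply/subset_leq_card/subsetP => y.
by rewrite !inE => /andP[/andP[-> _] ->].
Qed.

Lemma middle_vertex (T : oriented_graph) (A : {set T}) m n :
  tournament T -> m.*2.+1 + n.*2.+1 < #|A| ->
  exists z, [/\ z \in A, m < #|outs z A| & n < #|ins z A|].
Proof.
move=> tourT big.
have [z] : exists z, z \in A :\: ([set x in A | #|outs x A| <= m]
    :|: [set x in A | #|ins x A| <= n]).
  apply/set0Pn; rewrite setD_eq0; apply: contraL big => /subset_leq_card.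
  rewrite -leqNgt => /leq_trans->//; apply: leq_trans (leq_card_setU _ _) _.
  by rewrite leq_add ?few_small_outs ?few_small_ins.
rewrite !inE => /andP[h zA]; exists z.
by move: h; rewrite zA /= negb_or -!ltnNge => /andP[].
Qed.

(** * Finding the graph in regular tournaments *)

Lemma regular_degree (T : oriented_graph) (v : T) :
  regular_tournament T ->
  #|outs v setT| = #|T|.-1./2 /\ #|ins v setT| = #|T|.-1./2.
Proof.
move=> [tourT reg]; have := card_outs_ins v [set: T] tourT.
have := reg v; rewrite /indegree /outdegree.
have := cardsD1 v [set: T]; rewrite cardsT inE.
have -> : #|[set y | arc y v]| = #|ins v setT|.
  by apply: eq_card => y; rewrite !inE.
have -> : #|[set y | arc v y]| = #|outs v setT|.
  by apply: eq_card => y; rewrite !inE.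
lia.
Qed.

Lemma near_sink (T : oriented_graph) (v : T) :
  tournament T -> ~~ has_fan T -> 0 < #|outs v setT| ->
  exists2 M, M \in outs v setT &
    let s := #|outs M (outs v setT)| in s * s.+1 <= #|outs v setT|.*2.
Proof.
move=> tourT noF; set O := outs v setT => /card_gt0P[M0 M0O].
have [M MO maxM] := arg_maxnP (fun x => #|ins x O|) M0O.
have {}MO : M \in O := MO.
exists M => //=; set Y := outs M O; set Z := ins M O.
have YZ : #|Y| + #|Z| <= #|O|.
  by rewrite card_outs_ins // subset_leq_card ?subD1set.
apply: leq_trans (_ : (#|Y| + #|Z|).*2 <= _); last by rewrite leq_double.
(* The arcs from [Y] to [Z] are counted from both sides. *)
apply: (@leq_trans (\sum_(y in Y) #|outs y Z|).*2); last first.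
  rewrite leq_double; apply: star_forest_edges => y y' w w'.
  rewrite !inE /= => /andP[vy My] /andP[vy' My'] /andP[vw wM] /andP[vw' w'M].
  move=> ny nw yw yw' y'w; case/negP: noF.
  have vM : arc v M by move: MO; rewrite !inE.
  exact: (has_fanI (p0 := w) (p1 := M) (p2 := y) (x := w') (z := y') (a := v)).
have -> : #|Y| * #|Y|.+1 = (\sum_(y in Y) #|ins y Y|.+1).*2.
  under eq_bigr => y _ do rewrite -addn1.
  rewrite big_split /= doubleD -sum_outs_ins sum_outs // sum1_card; nia.
rewrite leq_double; apply: leq_sum => y yY.
have [yO My] : y \in O /\ arc M y by move: yY; rewrite inE => /andP[].
(* The 1 counts [M]. Maximality of [M] bounds this by |Z|, and [split_Z] then yields
   [#|ins y Y| + 1 <= #|outs y Z|]. *)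
have split_ins : #|ins y O| = #|ins y Y| + #|ins y Z| + 1.
  rewrite -(outs_ins M) (insC y) card_outs_ins // [LHS](cardsD1 M) addnC.
  by rewrite inE MO My.
have split_Z : #|outs y Z| + #|ins y Z| = #|Z|.
  rewrite card_outs_ins //; apply: eq_card => w; rewrite !inE.
  by have [->|//] := eqVneq w y; rewrite (negbTE (arc_asym My)) !andbF.
have := maxM y yO; rewrite -/Z; lia.
Qed.

Lemma regular_has_fan (T : oriented_graph) :
  regular_tournament T -> 201 <= #|T| -> has_fan T.
Proof.
move=> regT T201; have tourT := regT.1.
have deg v := regular_degree v regT.
have k100 : 100 <= #|T|.-1./2 by lia.
move: #|T|.-1./2 deg k100 => k deg k100.
have /card_gt0P[v _] : 0 < #|T| by apply: leq_trans T201.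
have [cO cI] := deg v; set O := outs v setT in cO; set I := ins v setT in cI.
have out_split y : y \in O -> #|outs y O| + #|outs y I| = k.
  rewrite inE => /andP[_ vy]; rewrite (outsC y) (outs_ins y) card_outs_ins //.
  rewrite -(deg y).1 [RHS](cardsD1 v) inE.
  by rewrite (negbTE (arc_asym vy)) andbF.
have in_out y : y \in O -> #|outs y O| + #|ins y O| = k.-1.
  by move=> yO; rewrite card_outs_ins // -cO (cardsD1 y O) yO.
have in_out_I y : y \in O -> #|outs y I| + #|ins y I| = k.
  rewrite inE => /andP[_ vy]; rewrite card_outs_ins // -cI (cardsD1 y I).
  by rewrite inE (negbTE (arc_asym vy)) andbF.
apply: contraT => noF.
have [|M MO] := near_sink (v := v) tourT noF; first by rewrite cO; lia.
rewrite /= -/O cO; set s := #|outs M O| => s_small.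
(* This needs 6s + 6 < k, which follows from s(s+1) <= 2k and k >= 100. *)
have [|z [zO z_out z_in]] := middle_vertex (A := O) (m := s.*2.+2) (n := s) tourT.
  by rewrite cO; nia.
(* [M] has k - s out-neighbours in [I], so it misses only s vertices there. *)
have nearM (B : {set T}) : B \subset I -> #|B| <= #|outs M B| + s.
  move=> BI; have := in_out_I M MO; have := out_split M MO; rewrite -/s => h1 h2.
  have -> : #|B| = #|outs M B| + #|ins M B|.
    rewrite card_outs_ins //; apply: eq_card => y; rewrite !inE.
    have [->|//] := eqVneq y M; apply/negbTE; apply: contraL MO.
    by move=> /(subsetP BI); rewrite !inE => /arc_asym.
  rewrite leq_add2l; apply: leq_trans (_ : #|ins M I| <= _); last by lia.
  apply/subset_leq_card/subsetP=> y.
  by rewrite [y \in ins M B]inE [y \in ins M I]inE => /andP[/(subsetP BI)->].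
(* By regularity [z] has at least 2s + 3 in-neighbours and s + 2 out-neighbours in [I]. So some [a]
   dominates s + 1 of the former, one of them dominated by [M]; among the latter, [M] dominates at
   least 2, leaving one besides [x]. *)
have := in_out z zO; have := in_out_I z zO; have := out_split z zO => h1 h2 h3.
have [|a] := large_outs (A := ins z I) tourT; first by lia.
rewrite 2!inE => /andP[/andP[_ av] az] a_out.
have subI (B : {set T}) y : B \subset I -> outs y B \subset I.
  by apply: subset_trans; apply/subsetP=> w; rewrite inE => /andP[].
have insI : ins z I \subset I by apply/subsetP=> w; rewrite inE => /andP[].
have /card_gt0P[x] : 0 < #|outs M (outs a (ins z I))|.
  by have := nearM _ (subI _ a insI); lia.
rewrite !inE /= => /andP[/andP[/andP[xv xz] ax] Mx].
have /card_gt0P[p0] : 0 < #|outs M (outs z I) :\ x|.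
  have := nearM _ (subI _ z (subxx I)); rewrite (cardsD1 x (outs M _)).
  by case: (x \in _); lia.
rewrite !inE /= => /andP[p0x /andP[/andP[p0v zp0] Mp0]].
(* The out-degrees of [M] and [z] in [O] differ. *)
have Mz : M != z by apply: contraTneq z_out => <-; rewrite -/s; lia.
move: MO zO; rewrite !inE /= => vM vz.
case/negP: noF.
exact: (has_fanI (p0 := p0) (p1 := v) (p2 := M) (x := x) (z := z) (a := a)).
Qed.

Lemma fan_turanable m : turanable (fan m).
Proof.
exists (maxn m 201) => T regT; rewrite geq_max => /andP[mT T201].
exact/has_fan_copy/regular_has_fan.
Qed.

Theorem proposition1p2 :
  exists F : nat -> oriented_graph,
    (forall i j : nat, i <> j -> ~ isomorphic (F i) (F j)) /\
    (forall i : nat, turanable (F i) /\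
       forall s : nat, 0 < s -> ~ contains_copy (D s) (F i)).
Proof.
exists (fun i => fan (6 + i)); split=> [i j ij [f /bij_eq_card]|i].
  by rewrite !card_ord => /addnI.
by split=> [|s _]; [exact: fan_turanable | exact: D_fan_free].
Qed.
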